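(* Let $\tilde A_i=(a_i;\,l_i^{\mu L},r_i^{\mu L},l_i^{\mu U},r_i^{\mu U};\,l_i^{\nu L},r_i^{\nu L},l_i^{\nu U},r_i^{\nu U})_{LR}$, $i=1,2$, be $LR$-type IVIFNs with the same shape functions, where $a_1+r_1^{\nu U}<0$ and $a_1+r_1^{\nu L}\ge0$, and $\tilde A_2$ is arbitrary. Then $\tilde A_1\odot\tilde A_2=(a;\,l^{\mu L},r^{\mu L},l^{\mu U},r^{\mu U};\,l^{\nu L},r^{\nu L},l^{\nu U},r^{\nu U})_{LR}$, where $a=a_1a_2$; for each $\kappa\in\{\mu L,\mu U,\nu U\}$, $$l^\kappa=a_1a_2-\min\{(a_1+r_1^\kappa)(a_2+r_2^\kappa),(a_1-l_1^\kappa)(a_2+r_2^\kappa)\},\quad r^\kappa=\max\{(a_1-l_1^\kappa)(a_2-l_2^\kappa),(a_1+r_1^\kappa)(a_2-l_2^\kappa)\}-a_1a_2;$$ and for $\kappa=\nu L$, $$l^\kappa=a_1a_2-\min\{(a_1-l_1^\kappa)(a_2+r_2^\kappa),(a_1+r_1^\kappa)(a_2-l_2^\kappa)\},\quad r^\kappa=\max\{(a_1+r_1^\kappa)(a_2+r_2^\kappa),(a_1-l_1^\kappa)(a_2-l_2^\kappa)\}-a_1a_2.$$ Moreover the conditions for an $LR$-type representation hold: all eight spreads of the product are positive and $l^{\mu U}\ge l^{\mu L}$, $l^{\nu L}\ge l^{\nu U}$, $l^{\nu L}\ge l^{\mu L}$, $l^{\nu U}\ge l^{\mu U}$, and likewise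 with $r$ in place of $l$.
   Context: A shape function is a continuous, strictly decreasing, invertible $f:[0,\infty)\to[0,1]$ with $f(0)=1$ and $\lim_{x\to\infty}f(x)=0$. Fix shape functions $L,R,L',R'$. An $LR$-type interval-valued intuitionistic fuzzy number (IVIFN) is written $\tilde A=(a;l^{\mu L},r^{\mu L},l^{\mu U},r^{\mu U};l^{\nu L},r^{\nu L},l^{\nu U},r^{\nu U})_{LR}$, where $a\in\mathbb R$ is its mean value and the eight spreads are positive reals with $l^{\mu U}\ge l^{\mu L}$, $r^{\mu U}\ge r^{\mu L}$, $l^{\nu L}\ge l^{\nu U}$, $r^{\nu L}\ge r^{\nu U}$, $l^{\nu L}\ge l^{\mu L}$, $r^{\nu L}\ge r^{\mu L}$, $l^{\nu U}\ge l^{\mu U}$, $r^{\nu U}\ge r^{\mu U}$. It encodes a lower membership function equal to $L((a-x)/l^{\mu L})$ on $[a-l^{\mu L},a]$, $R((x-a)/r^{\mu L})$ on $[a,a+r^{\mu L}]$, and $0$ otherwise; an upper membership function of the same form with $L',R',l^{\mu U},r^{\mu U}$; a lower non-membership function equal to $1-L((a-x)/l^{\nu L})$ on $[a-l^{\nu L},a]$, $1-R((x-a)/r^{\nu L})$ on $[a,a+r^{\nu L}]$, and $1$ otherwise; and an upper non-membership function of the same form with $L',R',l^{\nu U},r^{\nu U}$. At each $x$ the supremum of the membership interval plus the supremum of the non-membership interval is at most $1$. The product $\tilde A_1\odot\tilde A_2$ is formed cutwise by interval multiplication and read off at the level where the inverse shape functions equal $0$ (giving the mean) and at the level where they equal $1$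 (giving the spreads). That is, it is the tuple (with the same shape functions) with mean $a=a_1a_2$ and spreads determined, for each $\kappa\in\{\mu L,\mu U,\nu L,\nu U\}$, by $$[a-l^{\kappa},a+r^{\kappa}]=[a_1-l_1^{\kappa},a_1+r_1^{\kappa}]\times[a_2-l_2^{\kappa},a_2+r_2^{\kappa}],$$ where $I\times J=\{xy:x\in I,y\in J\}$. *)

(* Defs.v *)
From HB Require Import structures.
From mathcomp Require Import all_boot all_order all_algebra.
From mathcomp Require Import all_classical all_reals all_analysis.
Set Implicit Arguments.
Unset Strict Implicit.
Unset Printing Implicit Defensive.
Import Order.TTheory GRing.Theory Num.Theory.
Import numFieldNormedType.Exports.
Local Open Scope classical_set_scope.
Local Open Scope ring_scope.

(* Only the values of [f] on [0, +oo[ are constrained. A strictly decreasing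
   function with limit 0 never attains 0, so "invertible" is understood onto
   the range ]0, 1] of [f]. *)
Definition shape_function (R : realType) (f : R -> R) : Prop :=
  [/\ {within `[0, +oo[, continuous f},
      {in `[0, +oo[ &, {homo f : x y /~ x < y}},
      set_bij `[0, +oo[ `]0, 1] f,
      f 0 = 1
    & f x @[x --> +oo] --> 0].

(* Lower/upper (L/U) membership (mu) and non-membership (nu). *)
Inductive kind := muL | muU | nuL | nuU.

(* The bare data (a; l^muL, r^muL, ..., l^nuU, r^nuU), without conditions. *)
Record lr_tuple (R : realType) := LRTuple {
  mean : R;
  lspread : kind -> R;
  rspread : kind -> R }.

Definition spread_conditions (R : realType) (s : kind -> R) : Prop :=
  [/\ forall k, 0 < s k,
      s muL <= s muU,
      s nuU <= s nuL,
      s muL <= s nuL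
    & s muU <= s nuU].

Definition lr_curve (R : realType) (f g : R -> R) (a l r x : R) : R :=
  if a - l <= x <= a then f ((a - x) / l)
  else if a <= x <= a + r then g ((x - a) / r)
  else 0.

Definition grade (R : realType) (fL fR fL' fR' : R -> R) (A : lr_tuple R)
    (k : kind) (x : R) : R :=
  let a := mean A in let l := lspread A k in let r := rspread A k in
  match k with
  | muL => lr_curve fL fR a l r x
  | muU => lr_curve fL' fR' a l r x
  | nuL => 1 - lr_curve fL fR a l r x
  | nuU => 1 - lr_curve fL' fR' a l r x
  end.

(* The suprema of the membership and non-membership intervals at [x] are the
   upper grades at [x]. *)
Definition is_LR_IVIFN (R : realType) (fL fR fL' fR' : R -> R)
    (A : lr_tuple R) : Prop :=
  [/\ spread_conditions (lspread A),
      spread_conditions (rspread A)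
    & forall x, grade fL fR fL' fR' A muU x + grade fL fR fL' fR' A nuU x <= 1].

Definition spread_itv (R : realType) (A : lr_tuple R) (k : kind) : set R :=
  [set` `[mean A - lspread A k, mean A + rspread A k]].

(* [is_product A B C]: C is the product of A and B; the equality of sets
   determines the spreads of C. *)
Definition is_product (R : realType) (A B C : lr_tuple R) : Prop :=
  mean C = mean A * mean B /\
  forall k, spread_itv C k = [set x * y | x in spread_itv A k & y in spread_itv B k].

(* Main.v *)
(* The minimum and maximum of x y over a rectangle [p, q] x [s, t] sit at
   corners, which the signs of p and q select, and every value in between is
   attained by the intermediate value theorem. Since (mean A1, mean A2) is
   interior to the rectangle and mean A1 < 0, the product of the means lies
   strictly between the extrema; the order relations between the spreads of the
   product say that products of nested intervals are nested. The condition on the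
   grades follows from the order of the spreads: widening the spreads of an LR
   curve can only raise it. *)
Require Import Defs.
From HB Require Import structures.
From mathcomp Require Import all_boot all_order all_algebra.
From mathcomp Require Import all_classical all_reals all_analysis.
From mathcomp Require Import lra.
Import Order.TTheory GRing.Theory Num.Theory.
Import numFieldNormedType.Exports.
Local Open Scope classical_set_scope.
Local Open Scope ring_scope.

Set Implicit Arguments.
Unset Strict Implicit.
Unset Printing Implicit Defensive.

(** * Products of closed intervals *)

Lemma segment_eq (R : realType) (a b c d : R) :
  c <= d -> [set` `[a, b]] = [set` `[c, d]] -> a = c /\ b = d.
Proof.
move=> cd E.
have mem (x : R) : (a <= x <= b) = (c <= x <= d).
  have := congr1 (fun S : set R => S x) E.
  by rewrite /= !in_itv /= => e; apply/idP/idP; rewrite e.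
(* Since [c <= d], both [c] and [d] lie in [[a, b]], which is then nonempty too, and the argument
   can be reversed. *)
have /andP[ac cb] : a <= c <= b by rewrite mem lexx cd.
have /andP[ad db] : a <= d <= b by rewrite mem lexx cd.
have ab := le_trans ac cb.
have /andP[ca _] : c <= a <= d by rewrite -mem lexx ab.
have /andP[_ bd] : c <= b <= d by rewrite -mem lexx ab.
by split; apply/le_anti/andP.
Qed.

Lemma convex_combination_itv (R : realType) (p q x0 x1 u : R) :
  p <= x0 <= q -> p <= x1 <= q -> 0 <= u <= 1 -> p <= x0 + (x1 - x0) * u <= q.
Proof.
move=> /andP[? ?] /andP[? ?] /andP[u0 u1]; have v0 : 0 <= 1 - u by lra.
have ? : 0 <= u * (x1 - p) by apply: mulr_ge0; lra.
have ? : 0 <= u * (q - x1) by apply: mulr_ge0; lra.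
have ? : 0 <= (1 - u) * (x0 - p) by apply: mulr_ge0; lra.
have ? : 0 <= (1 - u) * (q - x0) by apply: mulr_ge0; lra.
by apply/andP; split; lra.
Qed.

(** Along the straight path from [(x0, y0)] to [(x1, y1)], which stays in the rectangle by
    convexity, the product is a polynomial in the parameter, so the intermediate value theorem for
    polynomials on [[0, 1]] suffices. *)
Lemma mul_ivt (R : realType) (p q s t x0 y0 x1 y1 z : R) :
  p <= x0 <= q -> p <= x1 <= q -> s <= y0 <= t -> s <= y1 <= t ->
  x0 * y0 <= z <= x1 * y1 ->
  exists x y, [/\ p <= x <= q, s <= y <= t & x * y = z].
Proof.
move=> /andP[? ?] /andP[? ?] /andP[? ?] /andP[? ?] /andP[z0 z1].
pose P : {poly R} := (x0%:P + (x1 - x0)%:P * 'X) * (y0%:P + (y1 - y0)%:P * 'X)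
  - z%:P.
have PE u : P.[u] = (x0 + (x1 - x0) * u) * (y0 + (y1 - y0) * u) - z.
  by rewrite !(hornerD, hornerN, hornerM, hornerC, hornerX).
have [||u /andP[u0 u1] /rootP] := @poly_ivt R P 0 1.
- exact: ler01.
- by rewrite !PE !(mulr0, mulr1, addr0) !subrKC subr_le0 subr_ge0 z0.
rewrite PE => /eqP; rewrite subr_eq0 => /eqP Pu.
exists (x0 + (x1 - x0) * u), (y0 + (y1 - y0) * u).
by split=> //; apply: convex_combination_itv; apply/andP.
Qed.

Lemma mul_segments (R : realType) (p q s t m M : R) :
  (forall x y, p <= x <= q -> s <= y <= t -> m <= x * y <= M) ->
  (exists x y, [/\ p <= x <= q, s <= y <= t & x * y = m]) ->
  (exists x y, [/\ p <= x <= q, s <= y <= t & x * y = M]) ->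
  [set` `[m, M]] = [set x * y | x in [set` `[p, q]] & y in [set` `[s, t]]].
Proof.
move=> bnd [x0 [y0 [x0I y0J m0]]] [x1 [y1 [x1I y1J M0]]]; subst m M.
apply/seteqP; split => z /=.
  rewrite in_itv /= => zI.
  have [x [y [xI yJ <-]]] := mul_ivt x0I x1I y0J y1J zI.
  by exists x; rewrite /= ?in_itv //; exists y; rewrite /= ?in_itv.
by move=> [x]; rewrite /= in_itv /= => xI [y]; rewrite /= in_itv /= => yJ <-;
  rewrite in_itv /= bnd.
Qed.

Lemma mul_segments_neg (R : realType) (p q s t : R) :
  p <= q -> q < 0 -> s <= t ->
  [set` `[Num.min (q * t) (p * t), Num.max (p * s) (q * s)]] =
  [set x * y | x in [set` `[p, q]] & y in [set` `[s, t]]].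
Proof.
move=> pq q0 st; apply: mul_segments.
- move=> x y /andP[px xq] /andP[sy yt].
  rewrite ge_min le_max; apply/andP; split.
    (* As [x < 0], lowering the product means raising [y] to [t]; the sign of [t] then tells which
       end of [[p, q]] is best. The upper bound is the same with [s]. *)
    by case: (leP 0 t) => ?; apply/orP; [right|left]; nra.
  by case: (leP 0 s) => ?; apply/orP; [right|left]; nra.
- by case: (leP (q * t) (p * t)) => _; [exists q, t|exists p, t];
    rewrite !lexx pq st.
- by case: (leP (p * s) (q * s)) => _; [exists q, s|exists p, s];
    rewrite !lexx pq st.
Qed.

Lemma mul_segments_straddle (R : realType) (p q s t : R) :
  p < 0 -> 0 <= q -> s <= t ->
  [set` `[Num.min (p * t) (q * s), Num.max (q * t) (p * s)]] =
  [set x * y | x in [set` `[p, q]] & y in [set` `[s, t]]].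
Proof.
move=> p0 q0 st; have pq : p <= q by lra.
apply: mul_segments.
- move=> x y /andP[px xq] /andP[sy yt].
  rewrite ge_min le_max; apply/andP; split.
    (* If [x] and [y] have opposite signs, the corner in their quadrant bounds [x * y] from below;
       otherwise [x * y >= 0] and some candidate corner is at most 0. The upper bound exchanges the
       two situations. *)
    case: (leP 0 y) => ?; case: (leP 0 x) => ?; apply/orP.
    + case: (leP 0 s) => ?; last by right; nra.
      by left; nra.
    + by left; nra.
    + by right; nra.
    + case: (leP t 0) => ?; last by left; nra.
      by right; nra.
  case: (leP 0 y) => ?; case: (leP 0 x) => ?; apply/orP.
  + by left; nra.
  + case: (leP s 0) => ?; last by left; nra.
    by right; nra.
  + case: (leP 0 t) => ?; first by left; nra.
    by right; nra.
  + by right; nra.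
- by case: (leP (p * t) (q * s)) => _; [exists p, t|exists q, s];
    rewrite !lexx pq st.
- by case: (leP (q * t) (p * s)) => _; [exists p, s|exists q, t];
    rewrite !lexx pq st.
Qed.

Lemma mul_segments_itv_bounds (R : realType) (p q s t m M x y : R) :
  [set` `[m, M]] = [set x * y | x in [set` `[p, q]] & y in [set` `[s, t]]] ->
  p <= x <= q -> s <= y <= t -> m <= x * y <= M.
Proof.
move=> E xI yJ; suff : [set` `[m, M]] (x * y) by rewrite /= in_itv.
by rewrite E; exists x; rewrite /= ?in_itv //; exists y; rewrite /= ?in_itv.
Qed.

(** The hypothesis [m <= M] makes both endpoints members of the smaller product, hence of the larger
    one. *)
Lemma mul_segments_subset (R : realType) (p q s t m M p' q' s' t' m' M' : R) :
  p' <= p -> q <= q' -> s' <= s -> t <= t' -> m <= M ->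
  [set` `[m, M]] = [set x * y | x in [set` `[p, q]] & y in [set` `[s, t]]] ->
  [set` `[m', M']] =
    [set x * y | x in [set` `[p', q']] & y in [set` `[s', t']]] ->
  m' <= m /\ M <= M'.
Proof.
move=> pp qq ss tt mM E E'.
have sub z : m <= z <= M -> m' <= z <= M'.
  move=> zI; have : [set` `[m, M]] z by rewrite /= in_itv.
  rewrite E => -[x /=]; rewrite in_itv /= => /andP[px xq] [y /=].
  rewrite in_itv /= => /andP[sy yt] <-.
  by apply: (mul_segments_itv_bounds E'); apply/andP; split;
    [apply: le_trans px|apply: le_trans qq|apply: le_trans sy|apply: le_trans tt].
have /sub/andP[-> _] : m <= m <= M by rewrite lexx.
by have /sub/andP[_ ->] : m <= M <= M by rewrite lexx andbT.
Qed.

(** * Monotonicity of shape functions and LR curves *)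

Lemma shape_function_antimono (R : realType) (f : R -> R) (x y : R) :
  shape_function f -> 0 <= x -> x <= y -> f y <= f x.
Proof.
move=> [_ fdec _ _ _] x0; rewrite le_eqVlt => /predU1P[->//|xy].
by apply/ltW/fdec; rewrite // in_itv /= andbT // (le_trans x0 (ltW xy)).
Qed.

Lemma shape_function_gt0 (R : realType) (f : R -> R) (x : R) :
  shape_function f -> 0 <= x -> 0 < f x.
Proof.
move=> [_ _ [ffun _ _] _ _] x0; have /ffun : [set` `[0, +oo[] x.
  by rewrite /= in_itv /= andbT.
by rewrite /= in_itv /= => /andP[].
Qed.

Lemma lr_curve_ge0 (R : realType) (f g : R -> R) (a l r x : R) :
  shape_function f -> shape_function g -> 0 < l -> 0 < r ->
  0 <= lr_curve f g a l r x.
Proof.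
move=> hf hg l0 r0; rewrite /lr_curve.
case: ifP => [/andP[_ xa]|_].
  by apply/ltW/(shape_function_gt0 hf)/divr_ge0; lra.
case: ifP => [/andP[ax _]|//].
by apply/ltW/(shape_function_gt0 hg)/divr_ge0; lra.
Qed.

(** A larger spread shrinks the argument of a decreasing function; where the narrower curve is 0,
    nonnegativity of the wider one is enough. *)
Lemma lr_curve_le (R : realType) (f g : R -> R) (a l r l' r' x : R) :
  shape_function f -> shape_function g ->
  0 < l -> 0 < r -> l <= l' -> r <= r' ->
  lr_curve f g a l r x <= lr_curve f g a l' r' x.
Proof.
move=> hf hg l0 r0 ll rr.
have l'0 := lt_le_trans l0 ll; have r'0 := lt_le_trans r0 rr.
rewrite {1}/lr_curve; case: ifP => [/andP[lx xa]|lxa].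
  rewrite /lr_curve ifT; last by apply/andP; split; lra.
  apply: (shape_function_antimono hf); first by apply: divr_ge0; lra.
  by apply: ler_wpM2l; [lra|rewrite lef_pV2].
case: ifP => [/andP[ax xr]|_]; last exact: lr_curve_ge0.
(* The point [x = a] passes the first test, so it must be excluded before the wider curve can be
   sent to its right branch. *)
have xa : a < x.
  by move/negbT: lxa; rewrite negb_and -!ltNge => /orP[|//]; lra.
rewrite /lr_curve ifF; last by apply/negbTE; rewrite negb_and -!ltNge xa orbT.
rewrite ifT; last by apply/andP; split; lra.
apply: (shape_function_antimono hg); first by apply: divr_ge0; lra.
by apply: ler_wpM2l; [lra|rewrite lef_pV2].
Qed.

Lemma spread_conditions_LR_IVIFN (R : realType) (fL fR fL' fR' : R -> R)
    (A : lr_tuple R) :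
  shape_function fL' -> shape_function fR' ->
  spread_conditions (lspread A) -> spread_conditions (rspread A) ->
  is_LR_IVIFN fL fR fL' fR' A.
Proof.
move=> hL hR cl cr; split=> // x.
have [l0 _ _ _ ll] := cl; have [r0 _ _ _ rr] := cr.
have := lr_curve_le (mean A) x hL hR (l0 muU) (r0 muU) ll rr.
by rewrite /grade; lra.
Qed.

(** * Products of tuples *)

Lemma is_product_unique (R : realType) (A B C P : lr_tuple R) :
  (forall k, 0 <= lspread P k) -> (forall k, 0 <= rspread P k) ->
  is_product A B P -> is_product A B C <-> C = P.
Proof.
move=> l0 r0 pP; split=> [[mC iC]|->//].
case: pP => mP iP; have E k : lspread C k = lspread P k /\
    rspread C k = rspread P k.
  (* The nonnegative spreads of [P] make its interval nonempty, so that the interval determines its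
     endpoints. *)
  have := iC k; rewrite -iP /spread_itv mC mP => /segment_eq[].
    by have := l0 k; have := r0 k; lra.
  by move=> *; split; lra.
case: C P mC mP E {iC iP l0 r0} => [mC lC rC] [mP lP rP] /= -> -> E.
by congr LRTuple; apply/funext => k; case: (E k).
Qed.

(* The means are interior to the factors, so [mean A * mean B] lies strictly
   between its neighbours [mean A * y] with [y] an endpoint of the second. *)
Lemma is_product_spread_gt0 (R : realType) (A B P : lr_tuple R) (k : kind) :
  mean A < 0 -> 0 < lspread A k -> 0 < rspread A k ->
  0 < lspread B k -> 0 < rspread B k -> is_product A B P ->
  0 < lspread P k /\ 0 < rspread P k.
Proof.
move=> a0 lA rA lB rB [mP /(_ k)]; rewrite /spread_itv => E.
have aI : mean A - lspread A k <= mean A <= mean A + rspread A k.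
  by apply/andP; split; lra.
have := mul_segments_itv_bounds (y := mean B + rspread B k) E aI.
have := mul_segments_itv_bounds (y := mean B - lspread B k) E aI.
rewrite mP => h1 h2.
have /h1/andP[_ u] : mean B - lspread B k <= mean B - lspread B k
   <= mean B + rspread B k by apply/andP; split; lra.
have /h2/andP[v _] : mean B - lspread B k <= mean B + rspread B k
   <= mean B + rspread B k by apply/andP; split; lra.
by split; nra.
Qed.

Lemma is_product_spread_le (R : realType) (A B P : lr_tuple R) (k k' : kind) :
  lspread A k <= lspread A k' -> rspread A k <= rspread A k' ->
  lspread B k <= lspread B k' -> rspread B k <= rspread B k' ->
  0 <= lspread P k -> 0 <= rspread P k -> is_product A B P ->
  lspread P k <= lspread P k' /\ rspread P k <= rspread P k'.
Proof.
move=> lA rA lB rB l0 r0 [_ E].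
have := E k; have := E k'; rewrite /spread_itv => E' E0.
by have [|||||? ?] := mul_segments_subset _ _ _ _ _ E0 E';
  [lra | lra | lra | lra | lra | split; lra].
Qed.

(** The argument rests on [is_product] alone, so no corner formula enters the comparison of the
    spreads. *)
Lemma is_product_LR_IVIFN (R : realType) (fL fR fL' fR' : R -> R)
    (A B P : lr_tuple R) :
  shape_function fL' -> shape_function fR' ->
  is_LR_IVIFN fL fR fL' fR' A -> is_LR_IVIFN fL fR fL' fR' B ->
  mean A < 0 -> is_product A B P -> is_LR_IVIFN fL fR fL' fR' P.
Proof.
move=> hL' hR' [[lA lA1 lA2 lA3 lA4] [rA rA1 rA2 rA3 rA4] _].
move=> [[lB lB1 lB2 lB3 lB4] [rB rB1 rB2 rB3 rB4] _] a0 pP.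
have gt0 k := is_product_spread_gt0 a0 (lA k) (rA k) (lB k) (rB k) pP.
have l0 k : 0 < lspread P k by case: (gt0 k).
have r0 k : 0 < rspread P k by case: (gt0 k).
have le k k' lAk rAk lBk rBk := @is_product_spread_le R A B P k k'
  lAk rAk lBk rBk (ltW (l0 k)) (ltW (r0 k)) pP.
have [l1 r1] := le _ _ lA1 rA1 lB1 rB1.
have [l2 r2] := le _ _ lA2 rA2 lB2 rB2.
have [l3 r3] := le _ _ lA3 rA3 lB3 rB3.
have [l4 r4] := le _ _ lA4 rA4 lB4 rB4.
by apply: spread_conditions_LR_IVIFN.
Qed.

Theorem proposition3p1p10 (R : realType) (fL fR fL' fR' : R -> R)
  (hL : shape_function fL) (hR : shape_function fR)
  (hL' : shape_function fL') (hR' : shape_function fR')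
  (A1 A2 : lr_tuple R)
  (hA1 : is_LR_IVIFN fL fR fL' fR' A1)
  (hA2 : is_LR_IVIFN fL fR fL' fR' A2)
  (hneg : mean A1 + rspread A1 nuU < 0)
  (hpos : 0 <= mean A1 + rspread A1 nuL) :
  let a1 := mean A1 in let l1 := lspread A1 in let r1 := rspread A1 in
  let a2 := mean A2 in let l2 := lspread A2 in let r2 := rspread A2 in
  let P := {|
    mean := a1 * a2;
    lspread := fun k =>
      match k with
      | muL | muU | nuU =>
          a1 * a2 - Num.min ((a1 + r1 k) * (a2 + r2 k))
                            ((a1 - l1 k) * (a2 + r2 k))
      | nuL =>
          a1 * a2 - Num.min ((a1 - l1 k) * (a2 + r2 k))
                            ((a1 + r1 k) * (a2 - l2 k))
      end;
    rspread := fun k =>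
      match k with
      | muL | muU | nuU =>
          Num.max ((a1 - l1 k) * (a2 - l2 k))
                  ((a1 + r1 k) * (a2 - l2 k)) - a1 * a2
      | nuL =>
          Num.max ((a1 + r1 k) * (a2 + r2 k))
                  ((a1 - l1 k) * (a2 - l2 k)) - a1 * a2
      end |} in
  (forall C : lr_tuple R, is_product A1 A2 C <-> C = P) /\
  is_LR_IVIFN fL fR fL' fR' P.
Proof.
move=> a1 l1 r1 a2 l2 r2 P.
have [[l1_gt0 _ _ _ _] [r1_gt0 r1mu _ _ r1U] _] := hA1.
have [[l2_gt0 _ _ _ _] [r2_gt0 _ _ _ _] _] := hA2.
have a1_lt0 : a1 < 0 by have := r1_gt0 nuU; rewrite /a1; lra.
have st k : a2 - l2 k <= a2 + r2 k.
  by have := l2_gt0 k; have := r2_gt0 k; rewrite /l2 /r2; lra.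
have pq k : a1 - l1 k <= a1 + r1 k.
  by have := l1_gt0 k; have := r1_gt0 k; rewrite /l1 /r1; lra.
have pP : is_product A1 A2 P.
  split=> // k; rewrite /spread_itv /=.
  (* For [muL] and [muU], the order of the right spreads gives [a1 + r1 k <= a1 + r1 nuU < 0]. For
     [nuL], [hpos] and [0 < l1 nuL] put the endpoints on either side of 0. *)
  have := l1_gt0 nuL; case: k; rewrite subKr subrKC => ?;
    [apply: mul_segments_neg | apply: mul_segments_neg
    | apply: mul_segments_straddle | apply: mul_segments_neg];
    by rewrite // /a1 /l1 /r1 in a1_lt0 *; lra.
have LRP := is_product_LR_IVIFN hL' hR' hA1 hA2 a1_lt0 pP.
split=> // C; have [[lP _ _ _ _] [rP _ _ _ _] _] := LRP.
by apply: is_product_unique => // k; apply: ltW.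
Qed.
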